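(* Let $G$ be a connected graph and let $\varphi$, $\theta$ be the relations on $E(G)$ defined by: $\{u,v\}\mathrel{\varphi}\{x,y\}$ iff $d(u,x)=d(v,y)$ and $d(u,y)=d(v,x)$; and $\{u,v\}\mathrel{\theta}\{x,y\}$ iff $d(u,x)+d(v,y)\neq d(u,y)+d(v,x)$. (a) If $G$ is a partial cube, then $\varphi$ coincides with $\theta$, is an equivalence relation on $E(G)$, and its classes are exactly the Djoković cuts, i.e. the coordinate classes of any isometric hypercube embedding of $G$. (b) Conversely, if $G$ is bipartite, $\varphi$ is an equivalence relation, and every $\varphi$-class is an edge cut whose two sides are convex subgraphs of $G$, then $G$ is a partial cube and the $\varphi$-classes are its $\theta$-classes.
   Context: Graphs are finite, simple, connected and undirected; $d=d_G$ is the shortest-path distance. The hypercube $Q_k$ has vertex set $\mathbb{Z}_2^k$ with two vertices adjacent iff they differ in exactly one coordinate. A partial cube is a graph admitting an isometric (distance-preserving) embedding into some $Q_k$. Given an isometric embedding of $G$ into a hypercube, the coordinate class of coordinate $i$ is the set of edges of $G$ whose endpoints' labels differ in coordinate $i$ (only nonempty classes are considered). A subgraph is convex if it contains every shortest path of $G$ between any two of its vertices. *)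

(* Defs.v *)
From mathcomp Require Import all_boot zmodp.
Set Implicit Arguments.
Unset Strict Implicit.
Unset Printing Implicit Defensive.

Record sgraph := SGraph {
  vertex :> finType;
  adj : rel vertex;
  adj_sym : symmetric adj;
  adj_irrefl : irreflexive adj }.

Section Graph.
Variable G : sgraph.

Definition connected := forall x y : G, connect (@adj G) x y.

Definition bipartite :=
  exists A : {set G}, forall x y : G, adj x y -> (x \in A) != (y \in A).

Definition edges : {set {set G}} :=
  [set [set x; y] | x in [set: G], y in [set: G] & adj x y].

Definition has_walk (x y : G) (n : nat) : bool :=
  [exists p : n.-tuple G, path (@adj G) x p && (last x p == y)].

(* The least n < #|G| such that there is a walk of length n from x to y
   (#|G| if there is none, i.e. if x and y are not connected). *)
Definition dist (x y : G) : nat := find (has_walk x y) (iota 0 #|G|).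

(* The subgraph meant is the one induced by A, so that containing a path
   amounts to containing its vertices. *)
Definition convex (A : {set G}) :=
  forall (x : G) (p : seq G),
    path (@adj G) x p -> size p = dist x (last x p) ->
    x \in A -> last x p \in A -> {subset p <= A}.

Definition edge_cut (A : {set G}) : {set {set G}} :=
  [set [set x; y] | x in A, y in ~: A & adj x y].

(* Both conditions are invariant under exchanging u and v, and under
   exchanging x and y; see phiE and thetaE. *)
Definition phi (E F : {set G}) : bool :=
  [exists u : G, exists v : G, exists x : G, exists y : G,
    [&& E == [set u; v], F == [set x; y],
        dist u x == dist v y & dist u y == dist v x]].

Definition theta (E F : {set G}) : bool :=
  [exists u : G, exists v : G, exists x : G, exists y : G,
    [&& E == [set u; v], F == [set x; y] &
        dist u x + dist v y != dist u y + dist v x]].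

Definition phi_classes : {set {set {set G}}} := equivalence_partition phi edges.

Definition theta_classes : {set {set {set G}}} :=
  equivalence_partition theta edges.

Lemma has_walk_size (x : G) (p : seq G) :
  path (@adj G) x p -> has_walk x (last x p) (size p).
Proof. by move=> xp; apply/existsP; exists (in_tuple p); rewrite xp eqxx. Qed.

Lemma dist_min (x : G) (p : seq G) :
  path (@adj G) x p -> dist x (last x p) <= size p.
Proof.
move=> xp; rewrite leqNgt; apply/negP => lt.
have ltG : size p < #|G|.
  by apply: (leq_trans lt); rewrite -[leqRHS](size_iota 0) find_size.
by have := before_find 0 lt; rewrite nth_iota // add0n has_walk_size.
Qed.

Lemma dist_walk (x y : G) : connect (@adj G) x y ->
  exists p, [/\ path (@adj G) x p, last x p = y & size p = dist x y].
Proof.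
case/connectP=> p0 xp0 ->; case/shortenP: xp0 => p xp up _.
have ltG : size p < #|G|.
  by have := max_card (mem (x :: p)); rewrite (card_uniqP up).
have hasw : has (has_walk x (last x p)) (iota 0 #|G|).
  apply/hasP; exists (size p); first by rewrite mem_iota.
  exact: has_walk_size.
have := nth_find 0 hasw; rewrite nth_iota; last by rewrite -[ltnRHS](size_iota 0) -has_find.
case/existsP=> q /andP[xq /eqP lq]; exists q; split=> //.
by rewrite size_tuple.
Qed.

Lemma eq_set2 (T : finType) (u v x y : T) : [set u; v] = [set x; y] ->
  (u = x /\ v = y) \/ (u = y /\ v = x).
Proof.
move=> /setP E; move: (E u) (E v) (E x) (E y).
rewrite !inE !eqxx /= ?orbT.
move=> /esym/orP[]/eqP -> /esym/orP[]/eqP ->; rewrite ?eqxx ?orbT ?orbb.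
- by move=> _ /eqP->; left.
- by left.
- by right.
- by move=> /eqP-> _; left.
Qed.

Lemma phiE (u v x y : G) : phi [set u; v] [set x; y] =
  (dist u x == dist v y) && (dist u y == dist v x).
Proof.
apply/existsP/andP.
  case=> u' /existsP[v' /existsP[x' /existsP[y' /and4P[/eqP Eu /eqP Ex]]]].
  by case: (eq_set2 Eu) => -[-> ->]; case: (eq_set2 Ex) => -[-> ->];
    move=> /eqP-> /eqP->.
case=> d1 d2; exists u; apply/existsP; exists v; apply/existsP; exists x.
by apply/existsP; exists y; rewrite !eqxx d1 d2.
Qed.

Lemma thetaE (u v x y : G) : theta [set u; v] [set x; y] =
  (dist u x + dist v y != dist u y + dist v x).
Proof.
apply/existsP/idP.
  case=> u' /existsP[v' /existsP[x' /existsP[y' /and3P[/eqP Eu /eqP Ex]]]].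
  case: (eq_set2 Eu) => -[-> ->]; case: (eq_set2 Ex) => -[-> ->] //.
  - by rewrite eq_sym.
  - by rewrite eq_sym [X in X != _]addnC [X in _ != X]addnC.
  - by rewrite [X in X != _]addnC [X in _ != X]addnC.
move=> d1; exists u; apply/existsP; exists v; apply/existsP; exists x.
by apply/existsP; exists y; rewrite !eqxx d1.
Qed.

End Graph.

Definition isometric (G H : sgraph) (f : G -> H) :=
  forall x y : G, dist (f x) (f y) = dist x y.

Section Hypercube.
Variable k : nat.

Definition cube_vertex : finType := {ffun 'I_k -> 'Z_2}.

Definition cube_adj : rel cube_vertex :=
  fun x y => #|[set i | x i != y i]| == 1.

Lemma cube_adj_sym : symmetric cube_adj.
Proof.
move=> x y; rewrite /cube_adj; congr (#|pred_of_set _| == _).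
by apply/setP => i; rewrite !inE eq_sym.
Qed.

Lemma cube_adj_irrefl : irreflexive cube_adj.
Proof.
move=> x; rewrite /cube_adj (_ : [set i | x i != x i] = set0) ?cards0 //.
by apply/setP => i; rewrite !inE eqxx.
Qed.

Definition hypercube : sgraph := SGraph cube_adj_sym cube_adj_irrefl.

End Hypercube.

Definition partial_cube (G : sgraph) :=
  exists (k : nat) (f : G -> hypercube k), isometric f.

Section CoordinateClasses.
Variables (G : sgraph) (k : nat) (f : G -> hypercube k).

Definition coord_class (i : 'I_k) : {set {set G}} :=
  [set [set x; y] | x in [set: G], y in [set: G] &
    adj x y && ((f x : cube_vertex k) i != (f y : cube_vertex k) i)].

Definition coord_classes : {set {set {set G}}} :=
  [set coord_class i | i : 'I_k] :\ set0.

End CoordinateClasses.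

(* Main.v *)
(** In a partial cube the distance is a Hamming distance, so flipping the one
    coordinate [i] in which the ends of an edge differ changes the distance to
    any vertex by one, with a sign decided by the [i]-th bit of that vertex.
    Both [phi] and [theta] therefore say that two edges flip the same
    coordinate.

    Conversely, each class [C] provides the coordinate [u \in A], where [A] is
    a side of the cut [C].  Along a geodesic every edge flips exactly one
    coordinate, as the classes partition the edges, and by convexity of the
    two sides no coordinate is flipped twice. *)

Require Import Defs.
From mathcomp Require Import all_boot zmodp.
From mathcomp Require Import zify.

Set Implicit Arguments.
Unset Strict Implicit.
Unset Printing Implicit Defensive.

(** A bit has only two values, so flipping it inverts every comparison with a third bit. This
    decides the sign of each change of distance below. *)
Lemma Z2_neqb (a b c : 'Z_2) : a != b -> (b != c) = ~~ (a != c).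
Proof.
by case: a b c => [[|[|a]] ?] [[|[|b]] ?] [[|[|c]] ?].
Qed.

(** * Distance in the hypercube as Hamming distance *)

Section Hamming.
Variable k : nat.
Implicit Types u v w : hypercube k.

Definition bit (u : hypercube k) (i : 'I_k) : 'Z_2 := (u : cube_vertex k) i.

Definition hamming u v : nat := \sum_(i < k) (bit u i != bit v i).

Lemma cube_adjE u v : adj u v = (hamming u v == 1).
Proof.
rewrite /adj /= /cube_adj /hamming -sum1_card big_mkcond /=.
by congr (_ == 1); apply: eq_bigr => i _; rewrite inE; case: (_ != _).
Qed.

Lemma hamming_sym u v : hamming u v = hamming v u.
Proof. by apply: eq_bigr => i _; rewrite eq_sym. Qed.

Lemma hamming_refl u : hamming u u = 0.
Proof. by apply: big1 => i _; rewrite eqxx. Qed.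

Lemma hamming_triangle v u w : hamming u w <= hamming u v + hamming v w.
Proof.
rewrite -big_split; apply: leq_sum => i _ /=.
by case: (bit u i =P bit v i) => [->|_] //; case: (_ != bit w i).
Qed.

(** Adjacency with its coordinate named; [adj] itself only counts the differing coordinates. *)
Definition flips (u v : hypercube k) (i : 'I_k) : Prop :=
  bit u i != bit v i /\ forall j, j != i -> bit u j = bit v j.

Lemma flips_uniq u v i j : flips u v i -> bit u j != bit v j -> j = i.
Proof.
by move=> [_ uv]; apply: contraNeq => /uv ->.
Qed.

Lemma adj_flips u v : adj u v -> exists i, flips u v i.
Proof.
case/cards1P=> i /setP di; exists i; split=> [|j /negPf ji].
  by have := di i; rewrite !inE eqxx.
by have := di j; rewrite !inE ji => /negbFE/eqP.
Qed.

(** The two sums differ only in the term of [i]. Adding that term crosswise avoids truncated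
    subtraction. *)
Lemma flips_hamming u v w i : flips u v i ->
  hamming v w + (bit u i != bit w i) = hamming u w + (bit v i != bit w i).
Proof.
case=> _ uv; rewrite /hamming (bigD1 i) //= [in RHS](bigD1 i) //=.
rewrite (eq_bigr (fun j => (bit u j != bit w j) : nat)) => [|j /uv -> //].
lia.
Qed.

Lemma flips_adj u v i : flips u v i -> adj u v.
Proof.
move=> uv; rewrite cube_adjE; have := flips_hamming v uv.
by rewrite hamming_refl eqxx uv.1 addn0 => <-.
Qed.

(** Correct one wrong coordinate of [u] at a time: [w] below is [u] with the bit [i] taken from [v],
    hence one closer to [v]. *)
Lemma hamming_walk u v :
  exists p, [/\ path (@adj (hypercube k)) u p, last u p = v & size p = hamming u v].
Proof.
move: {2}(hamming u v) (erefl (hamming u v)) => n.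
elim: n u => [|n IHn] u huv.
  exists [::]; split=> //=; apply/ffunP => i.
  by move/eqP: huv; rewrite sum_nat_eq0 => /forallP/(_ i); rewrite eqb0 negbK => /eqP.
have [i uvi] : exists i, bit u i != bit v i.
  apply/existsP; apply: contra_eqT huv; rewrite negb_exists => /forallP uv.
  by rewrite /hamming big1 // => i _; rewrite (negPf (uv i)).
pose w : hypercube k := [ffun j => if j == i then bit v j else bit u j] : cube_vertex k.
have wi : bit w i = bit v i by rewrite /bit ffunE eqxx.
have uw : flips u w i.
  by split=> [|j /negPf ji]; [rewrite wi | rewrite {2}/bit ffunE ji].
have := flips_hamming v uw; rewrite wi eqxx uvi huv addn0 addn1 => -[hwv].
have [p [wp lp sp]] := IHn _ hwv.
exists (w :: p); split; [|by []|by rewrite /= sp hwv].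
by apply/andP; split; first exact: flips_adj uw.
Qed.

Lemma hamming_path u p :
  path (@adj (hypercube k)) u p -> hamming u (last u p) <= size p.
Proof.
elim: p u => [|v p IHp] u; first by rewrite hamming_refl.
case/andP; rewrite cube_adjE => /eqP uv /IHp vp.
by apply: leq_trans (hamming_triangle v _ _) _; rewrite uv add1n ltnS.
Qed.

Lemma dist_cube u v : dist u v = hamming u v.
Proof.
have [p [up lp sp]] := hamming_walk u v.
apply/eqP; rewrite eqn_leq -sp -{1}lp dist_min //=.
(* A shortest walk exists because [p] connects the two vertices; the triangle inequality along it
   gives the lower bound. *)
have [|q [uq lq <-]] := @dist_walk _ u v; first by apply/connectP; exists p.
by rewrite sp -lq hamming_path.
Qed.

End Hamming.

(** * Edges and cuts in an arbitrary graph *)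

Section GraphFacts.
Variable G : sgraph.

Lemma dist_adj (x y : G) : adj x y -> dist x y = 1.
Proof.
move=> xy; apply/eqP; rewrite eqn_leq; apply/andP; split.
  by apply: (@dist_min _ x [:: y]); rewrite /= xy.
have [[|z p] [_ /= lp <- //]] := dist_walk (connect1 xy).
by move: xy; rewrite lp adj_irrefl.
Qed.

Lemma edgesP (E : {set G}) :
  reflect (exists x y, adj x y /\ E = [set x; y]) (E \in edges G).
Proof.
apply: (iffP imset2P) => [[x y _]|[x [y [xy ->]]]].
  by rewrite !inE /= => xy ->; exists x, y.
by exists x y; rewrite ?inE.
Qed.

Lemma mem_edge_cut (A : {set G}) x y : adj x y ->
  ([set x; y] \in edge_cut A) = ((x \in A) != (y \in A)).
Proof.
move=> xy; apply/imset2P/idP => [[x' y' x'A]|].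
  rewrite !inE => /andP[/negPf y'A _] /eq_set2 [] [-> ->];
  by rewrite x'A y'A.
case: (boolP (x \in A)) => xA; case: (boolP (y \in A)) => yA //= _.
  by exists x y; rewrite // !inE yA.
by exists y x; rewrite 1?setUC // !inE xA adj_sym.
Qed.

End GraphFacts.

(** * Partial cubes: both relations compare flipped coordinates *)

Section IsometricEmbedding.
Variables (G : sgraph) (k : nat) (f : G -> hypercube k).
Hypothesis fiso : isometric f.

Lemma isometric_flips u v : adj u v -> exists i, flips (f u) (f v) i.
Proof.
by move=> uv; apply: adj_flips; rewrite cube_adjE -dist_cube fiso dist_adj.
Qed.

Lemma phi_theta_flips u v x y i j :
  flips (f u) (f v) i -> flips (f x) (f y) j ->
  phi [set u; v] [set x; y] = (i == j) /\ theta [set u; v] [set x; y] = (i == j).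
Proof.
move=> uv xy; rewrite phiE thetaE -!fiso !dist_cube.
have := flips_hamming (f x) uv; have := flips_hamming (f y) uv.
have := flips_hamming (f u) xy; have := flips_hamming (f v) xy.
rewrite ![hamming (f x) _]hamming_sym ![hamming (f y) _]hamming_sym.
rewrite !(Z2_neqb _ uv.1) !(Z2_neqb _ xy.1).
case: (eqVneq i j) => [ij|ij].
  (* Same coordinate: all comparisons reduce to whether [u] and [x] agree at [i]. If they do, [u],
     [x] and [v], [y] are equally far apart, and both crossed distances are larger by one; if not,
     smaller by one. *)
  rewrite -{}ij in xy *.
  have -> : bit (f x) i != bit (f v) i = (bit (f u) i == bit (f x) i).
    by rewrite eq_sym (Z2_neqb _ uv.1) negbK.
  have -> : bit (f u) i != bit (f y) i = (bit (f u) i == bit (f x) i).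
    by rewrite eq_sym (Z2_neqb _ xy.1) negbK eq_sym.
  rewrite [bit (f x) i == _]eq_sym.
  by case: (bit (f u) i == _) => /=; lia.
(* Distinct coordinates: [x] and [y] agree at [i], so passing from [u] to [v] changes the distances
   to [x] and to [y] by the same amount, 1 or -1. The sums in [theta] are then equal, while [phi]
   would make this change its own opposite. *)
rewrite -(xy.2 i ij) -(uv.2 j) 1?eq_sym //.
by case: (bit (f u) i == _); case: (bit (f u) j == _) => /=; lia.
Qed.

Lemma phi_theta : {in edges G &, forall E F, phi E F = theta E F}.
Proof.
move=> E F /edgesP[u [v [/isometric_flips[i uv] ->]]].
move=> /edgesP[x [y [/isometric_flips[j xy] ->]]].
by have [-> ->] := phi_theta_flips uv xy.
Qed.

Lemma phi_equivalence : {in edges G & &, equivalence_rel (@phi G)}.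
Proof.
move=> E F H /edgesP[u [v [/isometric_flips[i uv] ->]]].
move=> /edgesP[x [y [/isometric_flips[j xy] ->]]].
move=> /edgesP[z [t [/isometric_flips[l zt] ->]]].
rewrite (phi_theta_flips zt zt).1 (phi_theta_flips uv xy).1.
rewrite (phi_theta_flips uv zt).1 (phi_theta_flips xy zt).1.
by rewrite eqxx; split=> // /eqP->.
Qed.

Lemma coord_classP i E :
  reflect (exists x y, [/\ adj x y, E = [set x; y] & bit (f x) i != bit (f y) i])
          (E \in coord_class f i).
Proof.
apply: (iffP imset2P) => [[x y _]|[x [y [xy -> xyi]]]].
  by rewrite !inE /= => /andP[xy xyi] ->; exists x, y.
by exists x y; rewrite ?inE //= xy.
Qed.

Lemma coord_class_phi u v i : flips (f u) (f v) i ->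
  coord_class f i = [set F in edges G | phi [set u; v] F].
Proof.
move=> uv; apply/setP => F; rewrite inE; apply/coord_classP/andP.
  case=> x [y [xy -> xyi]]; split; first by apply/edgesP; exists x, y.
  have [j fxy] := isometric_flips xy.
  by rewrite (phi_theta_flips uv fxy).1 (flips_uniq fxy xyi).
case=> /edgesP[x [y [xy ->]]]; have [j fxy] := isometric_flips xy.
rewrite (phi_theta_flips uv fxy).1 => /eqP ij.
by exists x, y; rewrite ij; split=> //; case: fxy.
Qed.

Lemma phi_classes_coord : phi_classes G = coord_classes f.
Proof.
apply/setP => C; rewrite in_setD1; apply/imsetP/andP.
  case=> _ /edgesP[u [v [uv ->]]] ->; have [i fuv] := isometric_flips uv.
  have <- := coord_class_phi fuv; split; last exact: imset_f.
  apply/set0Pn; exists [set u; v]; apply/coord_classP.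
  by exists u, v; split=> //; case: fuv.
(* Removing the empty class supplies an edge that represents the coordinate [i]. *)
case=> /[swap] /imsetP[i _ ->] /set0Pn[_ /coord_classP[u [v [uv _ uvi]]]].
have [j fuv] := isometric_flips uv.
exists [set u; v]; first by apply/edgesP; exists u, v.
by rewrite (flips_uniq fuv uvi) (coord_class_phi fuv).
Qed.

End IsometricEmbedding.

(** * From convex cuts to an isometric embedding *)

Section ConvexCuts.
Variable G : sgraph.
Hypothesis Gconn : connected G.

(** A shorter walk from [y], preceded by the edge from [x], would beat the geodesic. *)
Lemma geodesic_behead (x y : G) p : path (@adj G) x (y :: p) ->
  (size p).+1 = dist x (last y p) -> size p = dist y (last y p).
Proof.
move=> /= /andP[xy yp] sp; apply/eqP; rewrite eqn_leq dist_min // andbT.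
have [q [yq lq sq]] := dist_walk (Gconn y (last y p)).
have := @dist_min _ x (y :: q); rewrite /= xy lq -sp ltnS -sq.
exact.
Qed.

Variables (k : nat) (A : 'I_k -> {set G}).
Hypothesis A_convex : forall i, convex (A i) /\ convex (~: A i).
Hypothesis A_cut : forall u v : G, adj u v ->
  exists2 i, (u \in A i) != (v \in A i) &
    forall j, j != i -> (u \in A j) = (v \in A j).

Definition side_map (u : G) : hypercube k :=
  [ffun i => inord (u \in A i) : 'Z_2] : cube_vertex k.

Lemma bit_side_map u v i :
  (bit (side_map u) i == bit (side_map v) i) = ((u \in A i) == (v \in A i)).
Proof.
by rewrite /bit !ffunE -val_eqE /= !inordK; case: (u \in A i); case: (v \in A i).
Qed.

(** By induction, it is enough that the first edge lowers the Hamming distance to the end by one,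
    that is, that its cut is not crossed again. *)
Lemma hamming_geodesic (x : G) p : path (@adj G) x p ->
  size p = dist x (last x p) -> size p = hamming (side_map x) (side_map (last x p)).
Proof.
elim: p x => [|y p IHp] x; first by rewrite hamming_refl.
move=> xyp sp; have /= /andP[xy yp] := xyp.
have hyp := IHp _ yp (geodesic_behead xyp sp).
have [i xyi xyj] := A_cut xy.
have fxy : flips (side_map x) (side_map y) i.
  split=> [|j /xyj e]; first by rewrite bit_side_map.
  by apply/eqP; rewrite bit_side_map e.
(* Otherwise [x] and the end lie on one side of the cut [i], and [y], on a geodesic between them, on
   the other. Either side may be that of [x], so both must be convex. *)
have yl : (y \in A i) = (last y p \in A i).
  have [cA cA'] := A_convex i.
  have := cA x _ xyp sp; have := cA' x _ xyp sp; rewrite !inE /= .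
  move: xyi; case: (x \in A i); case yA: (y \in A i) => //= _ h1 h2.
    by apply/esym/negP => /(h2 isT)/(_ y); rewrite mem_head yA => /(_ isT).
  apply/esym/negPn/negP => /(h1 isT)/(_ y).
  by rewrite !inE eqxx yA => /(_ isT).
have := flips_hamming (side_map (last y p)) fxy.
rewrite !bit_side_map -yl eqxx xyi addn0 addn1 -hyp.
exact.
Qed.

Lemma side_map_isometric : isometric side_map.
Proof.
move=> x y; have [p [xp lp sp]] := dist_walk (Gconn x y).
by rewrite dist_cube -sp -lp (hamming_geodesic xp) // lp.
Qed.

End ConvexCuts.

Lemma convex_cuts_partial_cube (G : sgraph) : connected G ->
  {in edges G & &, equivalence_rel (@phi G)} ->
  (forall C, C \in phi_classes G ->
     exists A : {set G}, [/\ C = edge_cut A, convex A & convex (~: A)]) ->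
  partial_cube G.
Proof.
move=> Gconn phi_eq cuts; exists #|phi_classes G|.
(* Finite choice fixes one side of each cut, with the classes numbered by [enum_val]. *)
have [|A HA] := @fin_all_exists 'I_#|phi_classes G| (fun=> {set G})
  (fun i A => [/\ enum_val i = edge_cut A, convex A & convex (~: A)]).
  by move=> i; apply/cuts/enum_valP.
exists (side_map A); apply: side_map_isometric => // [i|u v uv].
  by have [] := HA i.
have /and3P[/eqP cover_phi triv_phi _] := equivalence_partitionP phi_eq.
have cutE i : ((u \in A i) != (v \in A i)) = ([set u; v] \in enum_val i).
  by have [-> _ _] := HA i; rewrite mem_edge_cut.
(* Covering gives a cut that the edge crosses; disjointness of the classes excludes a second one. *)
have : [set u; v] \in cover (phi_classes G).
  by rewrite cover_phi; apply/edgesP; exists u, v.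
case/bigcupP => C CP; rewrite -(enum_rankK_in CP CP).
set i := enum_rank_in _ _ => uvi; exists i; first by rewrite cutE.
move=> j ji; apply/eqP/negPn; rewrite cutE; apply: contra ji => uvj.
apply/eqP/enum_val_inj/eqP/negPn/negP => ne.
have /pred0P/(_ [set u; v]) := trivIsetP triv_phi _ _ (enum_valP j) (enum_valP i) ne.
by rewrite /= uvj uvi.
Qed.

Theorem theorem2p13 (G : sgraph) (Gconn : connected G) :
  (partial_cube G ->
    [/\ {in edges G &, forall E F, phi E F = theta E F},
        {in edges G & &, equivalence_rel (@phi G)} &
        forall (k : nat) (f : G -> hypercube k),
          isometric f -> phi_classes G = coord_classes f])
  /\
  (bipartite G ->
   {in edges G & &, equivalence_rel (@phi G)} ->
   (forall C, C \in phi_classes G ->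
      exists A : {set G}, [/\ C = edge_cut A, convex A & convex (~: A)]) ->
   partial_cube G /\ phi_classes G = theta_classes G).
Proof.
split=> [[k [f fiso]]|_ phi_eq cuts].
  split; [exact: phi_theta fiso | exact: phi_equivalence fiso |].
  by move=> l g; exact: phi_classes_coord.
have Gpc := convex_cuts_partial_cube Gconn phi_eq cuts; split=> //.
(* The embedding just built makes [phi] and [theta] agree on edges, hence have the same classes. *)
have [k [f fiso]] := Gpc.
apply: eq_in_imset => E EG; apply/setP => F; rewrite !inE.
by case: (boolP (F \in edges G)) => //= FG; rewrite (phi_theta fiso).
Qed.
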